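(* Let $$\mathbf{Z}=\{\mathbf{v}\in[H^1_0(\Omega)]^2:\ b(\mathbf{v},q)=0\ \ \forall\,q\in L^2_0(\Omega)\},\qquad \mathbf{Z}_h=\{\mathbf{v}_h\in\mathbf{V}_h:\ b(\mathbf{v}_h,q_h)=0\ \ \forall\,q_h\in Q_h\}.$$ Then $\mathbf{Z}_h\subseteq\mathbf{Z}$. In particular, if $(\mathbf{u}_h,p_h)\in\mathbf{V}_h\times Q_h$ solves $$a_h(\mathbf{u}_h,\mathbf{v}_h)+b(\mathbf{v}_h,p_h)=(\mathbf{f}_h,\mathbf{v}_h)\ \ \forall\,\mathbf{v}_h\in\mathbf{V}_h,\qquad b(\mathbf{u}_h,q_h)=0\ \ \forall\, q_h\in Q_h,$$ then the discrete velocity $\mathbf{u}_h$ is exactly divergence-free: $\operatorname{div}\mathbf{u}_h=0$ in $\Omega$.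
   Context: Let $\Omega\subset\mathbb{R}^2$ be a polygon and $k\ge 2$ an integer. $\{\mathcal{T}_h\}_h$ is a sequence of decompositions of $\Omega$ into polygonal elements $K$ with diameter $h_K$, $h=\sup_{K\in\mathcal{T}_h}h_K$. There are constants $\gamma,c>0$ (independent of $h$) such that for all $h$ every $K\in\mathcal{T}_h$ satisfies: (A1) $K$ is star-shaped with respect to a ball of radius $\ge\gamma h_K$; (A2) the distance between any two vertices of $K$ is $\ge c\,h_K$. The viscosity $\nu\in L^\infty(\Omega)$ is uniformly positive and constant on each $K\in\mathcal{T}_h$. The load is $\mathbf{f}\in[L^2(\Omega)]^2$. $\mathbb{P}_m(K)$ denotes polynomials of degree $\le m$ on $K$; $\mathbb{B}_k(\partial K)$ is the set of $v\in C^0(\partial K)$ with $v_{|e}\in\mathbb{P}_k(e)$ for every edge $e\subset\partial K$; $\mathcal{G}_{k-2}(K)=\nabla(\mathbb{P}_{k-1}(K))\subseteq[\mathbb{P}_{k-2}(K)]^2$, and $\mathcal{G}_{k-2}(K)^\perp\subseteq[\mathbb{P}_{k-2}(K)]^2$ is its $L^2(K)$-orthogonal complement in $[\mathbb{P}_{k-2}(K)]^2$. All differential operators are understood in the weak sense. $\mathbf{V}_h^K$ is the set of $\mathbf{v}\in[H^1(K)]^2$ with $\mathbf{v}_{|\partial K}\in[\mathbb{B}_k(\partial K)]^2$, $\operatorname{div}\mathbf{v}\in\mathbb{P}_{k-1}(K)$, and $-\nu\boldsymbol{\Delta}\mathbf{v}-\nabla s\in\mathcal{G}_{k-2}(K)^\perp$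 for some $s\in L^2(K)$. Global spaces: $\mathbf{V}_h=\{\mathbf{v}\in[H^1_0(\Omega)]^2: \mathbf{v}_{|K}\in\mathbf{V}_h^K\ \forall K\in\mathcal{T}_h\}$, $Q_h=\{q\in L^2_0(\Omega): q_{|K}\in\mathbb{P}_{k-1}(K)\ \forall K\in\mathcal{T}_h\}$, where $L^2_0(\Omega)$ is the space of $L^2(\Omega)$ functions with zero integral. Forms: $b(\mathbf{v},q)=\int_\Omega(\operatorname{div}\mathbf{v})\,q$. $a^K(\mathbf{u},\mathbf{v})=\int_K\nu\,\boldsymbol{\nabla}\mathbf{u}:\boldsymbol{\nabla}\mathbf{v}$. The projection $\Pi_k^{\nabla,K}:\mathbf{V}_h^K\to[\mathbb{P}_k(K)]^2$ is defined by $a^K(\mathbf{q},\mathbf{v}-\Pi_k^{\nabla,K}\mathbf{v})=0$ for all $\mathbf{q}\in[\mathbb{P}_k(K)]^2$ and $P^{0,K}(\mathbf{v}-\Pi_k^{\nabla,K}\mathbf{v})=\mathbf{0}$, with $P^{0,K}$ the $L^2(K)$-projection onto constants. $\mathcal{S}^K$ is any symmetric bilinear form on $\mathbf{V}_h^K$ with $c_*a^K(\mathbf{v},\mathbf{v})\le\mathcal{S}^K(\mathbf{v},\mathbf{v})\le c^*a^K(\mathbf{v},\mathbf{v})$ for all $\mathbf{v}\in\mathbf{V}_h^K$ with $\Pi_k^{\nabla,K}\mathbf{v}=\mathbf{0}$, where $c_*,c^*>0$ are independent of $h$ and $K$. Then $a_h(\mathbf{u},\mathbf{v})=\sum_{K\in\mathcal{T}_h}\big[a^K(\Pi_k^{\nabla,K}\mathbf{u},\Pi_k^{\nabla,K}\mathbf{v})+\mathcal{S}^K((I-\Pi_k^{\nabla,K})\mathbf{u},(I-\Pi_k^{\nabla,K})\mathbf{v})\big]$.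 The approximate load is $\mathbf{f}_{h|K}=\Pi^{0,K}_{k-2}\mathbf{f}$, the $L^2(K)$-projection of $\mathbf{f}$ onto $[\mathbb{P}_{k-2}(K)]^2$, and $(\mathbf{f}_h,\mathbf{v})=\int_\Omega\mathbf{f}_h\cdot\mathbf{v}$. *)

(* Defs.v *)
(* MathComp-Analysis; scalars range over an arbitrary [R : realType]. *)
From HB Require Import structures.
From mathcomp Require Import all_boot all_order all_algebra.
From mathcomp Require Import all_classical all_reals all_analysis.

Set Implicit Arguments.
Unset Strict Implicit.
Unset Printing Implicit Defensive.

Import Order.TTheory GRing.Theory Num.Theory.
Import numFieldNormedType.Exports.

Local Open Scope classical_set_scope.
Local Open Scope ring_scope.

(* Scalar and vector fields are total functions on the plane. Those living on a
   domain [D] are only looked at on [D], up to equality almost everywhere, so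
   that restriction to a subdomain is the identity on representatives. *)
Notation plane R := (R * R)%type.
Notation sfield R := (plane R -> R).
Notation vfield R := ('I_2 -> plane R -> R).

Definition leb2 (R : realType) :
    {measure set (measurableTypeR R * measurableTypeR R) -> \bar R} :=
  (@lebesgue_measure R \x @lebesgue_measure R)%E.

Section PlaneGeometry.
Context {R : realType}.

(* The norm of the library on a product is the sup norm. *)
Definition eucl_dist (x y : plane R) : R :=
  Num.sqrt ((x.1 - y.1) ^+ 2 + (x.2 - y.2) ^+ 2).

Definition diam (D : set (plane R)) : R :=
  sup [set eucl_dist x y | x in D & y in D].

Definition seg (a b : plane R) (t : R) : plane R := a + t *: (b - a).

End PlaneGeometry.

(* A polygon is the bounded region enclosed by a simple closed polygonal line
   with vertices [vtx i] and edges from [vtx i] to [vtx (ordS i)], [ordS] being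
   the cyclic successor. A bounded domain whose boundary is that line is the
   region it encloses. Consecutive edges may be aligned. *)
Record polygon (R : realType) := Polygon {
  nvtx : nat;
  vtx : 'I_nvtx -> plane R;
  dom :> set (plane R);
  nvtx_ge3 : (3 <= nvtx)%N;
  vtx_simple : forall (i j : 'I_nvtx) (s t : R),
    0 <= s < 1 -> 0 <= t < 1 ->
    seg (vtx i) (vtx (ordS i)) s = seg (vtx j) (vtx (ordS j)) t ->
    i = j /\ s = t;
  dom_open : open dom;
  dom_nonempty : dom !=set0;
  dom_connected : connected dom;
  dom_bounded : bounded_set dom;
  dom_boundary : closure dom `\` dom =
    \bigcup_(i in [set: 'I_nvtx])
      [set seg (vtx i) (vtx (ordS i)) t | t in `[0, 1]] }.

Record decomposition (R : realType) (Omega : polygon R) := Decomposition {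
  ncell : nat;
  cell : 'I_ncell -> polygon R;
  cell_sub : forall i, cell i `<=` Omega;
  cell_disjoint : forall i j, i <> j -> cell i `&` cell j = set0;
  cell_cover :
    closure Omega = \bigcup_(i in [set: 'I_ncell]) closure (cell i) }.

Section MeshRegularity.
Context {R : realType}.

Definition star_shaped_ball (gamma : R) (K : polygon R) : Prop :=
  exists (x0 : plane R) (rho : R),
    gamma * diam K <= rho /\
    forall x y : plane R, eucl_dist x0 x < rho -> (K : set _) y ->
    forall t : R, 0 <= t <= 1 -> (K : set _) (seg x y t).

Definition separated_vertices (c : R) (K : polygon R) : Prop :=
  forall i j : 'I_(nvtx K), i <> j -> c * diam K <= eucl_dist (vtx i) (vtx j).

End MeshRegularity.

Section FunctionSpaces.
Context {R : realType}.
Implicit Types (D : set (plane R)) (f g : sfield R) (v : vfield R).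

Definition axis (i : 'I_2) : plane R := if i == ord0 then (1, 0) else (0, 1).

Definition pd (i : 'I_2) f : sfield R := fun x => 'D_(axis i) f x.

Definition smooth f : Prop :=
  forall s : seq 'I_2, let h := foldr pd f s in
    continuous h /\ forall i x, derivable h x (axis i).

Definition test_function D : set (sfield R) :=
  [set phi | [/\ smooth phi, compact (closure [set x | phi x != 0])
               & closure [set x | phi x != 0] `<=` D]].

Definition L2 D : set (sfield R) := [set f | f \_ D \in Lfun (leb2 R) 2%:E].

Definition Linfty D : set (sfield R) := [set f | f \_ D \in Lfun (leb2 R) +oo%E].

Definition aeq D f g : Prop := ae_eq (leb2 R) D f g.

Definition L20 D : set (sfield R) :=
  [set q | L2 D q /\ \int[leb2 R]_(x in D) q x = 0].

Definition is_weak_pd D (i : 'I_2) f g : Prop :=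
  L2 D g /\ forall phi, test_function D phi ->
    \int[leb2 R]_(x in D) (f x * pd i phi x) =
    - \int[leb2 R]_(x in D) (g x * phi x).

Definition H1 D : set (sfield R) :=
  [set f | L2 D f /\ forall i, exists g, is_weak_pd D i f g].

(* For [f] in [H1 D], a representative of the weak partial derivative on [D],
   which is unique up to equality a.e. on [D]. *)
Definition wpd D (i : 'I_2) f : sfield R := xget 0 [set g | is_weak_pd D i f g].

Definition wdiv D v : sfield R := fun x => \sum_(i < 2) wpd D i (v i) x.

(* Convergence in [H1 D] of smooth functions, whose weak derivatives are the
   classical ones. *)
Definition H1_cvg D (phi : nat -> sfield R) f : Prop :=
  ((fun n => \int[leb2 R]_(x in D) (phi n x - f x) ^+ 2) @ \oo --> (0 : R)) /\
  forall i, (fun n => \int[leb2 R]_(x in D) (pd i (phi n) x - wpd D i f x) ^+ 2)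
    @ \oo --> (0 : R).

(* The closure of the test functions in [H1 D]. *)
Definition H10 D : set (sfield R) :=
  [set f | H1 D f /\ exists phi : nat -> sfield R,
     (forall n, test_function D (phi n)) /\ H1_cvg D phi f].

(* [f] in [H1 K] has trace [g] on the boundary of [K]: the trace operator is
   the continuous extension, from [H1 K] to L^2 of the boundary, of the
   restriction of smooth functions. *)
Definition has_trace (K : polygon R) f g : Prop :=
  exists phi : nat -> sfield R,
    [/\ forall n, smooth (phi n), H1_cvg K phi f &
        forall i : 'I_(nvtx K),
          let x := seg (vtx i) (vtx (ordS i)) in
          (fun n => \int[@lebesgue_measure R]_(t in `[0, 1])
             ((phi n (x t) - g (x t)) ^+ 2 * eucl_dist (vtx i) (vtx (ordS i))))
            @ \oo --> (0 : R)].

(* Polynomials in two variables of total degree at most [m]. *)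
Definition Pol (m : nat) : set (sfield R) :=
  [set p | exists c : nat -> nat -> R, p = fun x =>
     \sum_(a < m.+1) \sum_(b < m.+1 | (a + b <= m)%N)
       c a b * x.1 ^+ a * x.2 ^+ b].

Definition vPol (m : nat) : set (vfield R) := [set p | forall i, Pol m (p i)].

Definition Bdry (k : nat) (K : polygon R) : set (sfield R) :=
  [set g | {within closure K `\` K, continuous g} /\
     forall i : 'I_(nvtx K), exists2 p : {poly R}, (size p <= k.+1)%N &
       forall t, 0 <= t <= 1 -> g (seg (vtx i) (vtx (ordS i)) t) = p.[t]].

Definition Grad (m : nat) : set (vfield R) :=
  [set w | exists2 p, Pol m.+1 p & forall i, w i = pd i p].

Definition dotL2 D (v w : vfield R) : R :=
  \int[leb2 R]_(x in D) \sum_(i < 2) v i x * w i x.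

Definition Grad_perp (m : nat) D : set (vfield R) :=
  [set w | vPol m w /\ forall z : vfield R, Grad m z -> dotL2 D w z = 0].

Definition L2proj (m : nat) D v : vfield R :=
  xget 0 [set p | vPol m p /\ forall q, vPol m q -> dotL2 D (v - p) q = 0].

End FunctionSpaces.

Section VirtualElements.
Context {R : realType} (nu : sfield R) (k : nat).
Implicit Types (K : polygon R) (u v w : vfield R).

Definition aK K u v : R :=
  \int[leb2 R]_(x in K)
    (nu x * \sum_(i < 2) \sum_(j < 2) wpd K i (u j) x * wpd K i (v j) x).

(* - nu Laplace v - grad s = w on [K], in the sense of distributions, for [nu]
   constant on [K]. *)
Definition stokes_weak K v (s : sfield R) w : Prop :=
  forall phi : vfield R, (forall i, test_function K (phi i)) ->
    \int[leb2 R]_(x in K)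
      (nu x * \sum_(i < 2) \sum_(j < 2) wpd K i (v j) x * pd i (phi j) x)
    + \int[leb2 R]_(x in K) (s x * \sum_(i < 2) pd i (phi i) x)
    = dotL2 K w phi.

Definition VK K : set (vfield R) :=
  [set v | [/\ forall i, H1 K (v i),
     forall i, exists2 g, Bdry k K g & has_trace K (v i) g,
     exists2 p, Pol k.-1 p & aeq K (wdiv K v) p &
     exists2 s, L2 K s & exists2 w, Grad_perp (k - 2) K w &
       stokes_weak K v s w]].

Definition PiK K v : vfield R :=
  xget 0 [set p | [/\ vPol k p,
     forall q, vPol k q -> aK K q (v - p) = 0 &
     L2proj 0 K (v - p) = 0]].

(* A symmetric bilinear form on [VK K], whose elements are classes modulo
   equality a.e. on [K], with the stability bounds on the kernel of [PiK K]. *)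
Definition stabilization (cl cu : R) K (S : vfield R -> vfield R -> R) : Prop :=
  [/\ forall u v, VK K u -> VK K v -> S u v = S v u,
      forall (r : R) u v w, VK K u -> VK K v -> VK K w ->
        S (r *: u + v) w = r * S u w + S v w,
      forall u v w, VK K u -> VK K v -> VK K w ->
        (forall i, aeq K (u i) (v i)) -> S u w = S v w &
      forall v, VK K v -> (PiK K v = 0) ->
        cl * aK K v v <= S v v <= cu * aK K v v].

Context {Omega : polygon R} (T : decomposition Omega).

Definition Vh : set (vfield R) :=
  [set v | (forall i, H10 Omega (v i)) /\ forall j : 'I_(ncell T), VK (cell j) v].

Definition Qh : set (sfield R) :=
  [set q | L20 Omega q /\ forall j : 'I_(ncell T),
     exists2 p, Pol k.-1 p & aeq (cell j) q p].

Definition ah (S : 'I_(ncell T) -> vfield R -> vfield R -> R) u v : R :=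
  \sum_(j < ncell T)
    (aK (cell j) (PiK (cell j) u) (PiK (cell j) v)
     + S j (u - PiK (cell j) u) (v - PiK (cell j) v)).

Definition fh (f : vfield R) : vfield R := fun i =>
  \sum_(j < ncell T) (L2proj (k - 2) (cell j) f i) \_ (cell j).

End VirtualElements.

Section DivergenceFree.
Context {R : realType}.

Definition bform (Omega : polygon R) (v : vfield R) (q : sfield R) : R :=
  \int[leb2 R]_(x in Omega) (wdiv Omega v x * q x).

Definition Zspace (Omega : polygon R) : set (vfield R) :=
  [set v | (forall i, H10 Omega (v i)) /\
     forall q, L20 Omega q -> bform Omega v q = 0].

Definition Zh (nu : sfield R) (k : nat) (Omega : polygon R)
    (T : decomposition Omega) : set (vfield R) :=
  [set v | Vh nu k T v /\ forall q, Qh k T q -> bform Omega v q = 0].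

End DivergenceFree.

(* Main.v *)
Require Import Defs.
From HB Require Import structures.
From mathcomp Require Import all_boot all_order all_algebra.
From mathcomp Require Import all_classical all_reals all_analysis.
From mathcomp Require Import measurable_realfun.
From mathcomp Require Import ring lra.

Set Implicit Arguments.
Unset Strict Implicit.
Unset Printing Implicit Defensive.

Import Order.TTheory GRing.Theory Num.Theory.
Import numFieldNormedType.Exports.

Local Open Scope classical_set_scope.
Local Open Scope ring_scope.

(** For [v] in [Zh] the divergence [div v] is itself an admissible test function
    of [Qh]: it is polynomial on every cell, and it has zero integral because [v]
    is an [H1]-limit of test functions. Testing with it gives
    [b(v, div v) = ||div v||^2 = 0]. The weak divergences on [Omega] and on a
    cell being defined separately, one needs that weak derivatives are unique
    almost everywhere, i.e. the fundamental lemma of the calculus of variations: a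
    function orthogonal to all test functions has zero integral over every box
    whose closure lies in the domain (indicators of boxes are bounded limits of
    test functions), hence over every measurable subset of such a box. *)

(** * Smooth functions on the plane built from [exp(-1/t)] *)

Section FlatFunctions.
Context {R : realType}.

(* The factor [t^-1 ^+ n] makes the family stable under differentiation. *)
Definition theta (n : nat) (t : R) : R :=
  if 0 < t then t^-1 ^+ n * expR (- t^-1) else 0.

Lemma theta_gt0 n t : 0 < t -> 0 < theta n t.
Proof. by move=> t0; rewrite /theta t0 mulr_gt0 ?expR_gt0// exprn_gt0// invr_gt0. Qed.

Lemma theta_le0 n t : t <= 0 -> theta n t = 0.
Proof. by move=> t0; rewrite /theta ltNge t0. Qed.

Lemma theta_ge0 n t : 0 <= theta n t.
Proof.
by have [/(theta_le0 n)->//|/(theta_gt0 n)/ltW] := lerP t 0.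
Qed.

Lemma theta0_lt1 t : theta 0 t < 1.
Proof.
rewrite /theta; case: ifPn => // t0.
by rewrite expr0 mul1r expR_lt1 oppr_lt0 invr_gt0.
Qed.

(** For [t > 0], put [u = 1/t]: one term of the exponential series gives
    [exp u >= u^(n+2) / (n+2)!], which is inverted. The quadratic order is what flattens [theta n]
    at the origin. *)
Lemma theta_le_sqr n t : theta n t <= (n.+2)`!%:R * t ^+ 2.
Proof.
rewrite /theta; case: ifPn => [t0|_]; last by rewrite mulr_ge0// sqr_ge0.
set u := t^-1; have u0 : 0 < u by rewrite invr_gt0.
have F0 : 0 < (n.+2)`!%:R :> R by rewrite ltr0n fact_gt0.
have E : u ^+ n.+2 / (n.+2)`!%:R <= expR u.
  by apply: le_trans (expR_ge1Dxn n.+1 (ltW u0)); rewrite lerDr.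
rewrite expRN -[t]invrK -/u exprVn.
rewrite ler_pdivrMr ?expR_gt0// exprVn.
apply: le_trans (ler_wpM2l _ E); last by rewrite mulr_ge0// invr_ge0 exprn_ge0// ltW.
rewrite -exprVn -/u -(add2n n) exprD le_eqVlt; apply/orP; left; apply/eqP.
by field; rewrite !gt_eqF.
Qed.

Lemma is_derive_theta n (t : R) :
  is_derive t 1 (theta n) (theta n.+2 t - n%:R * theta n.+1 t).
Proof.
have [t0|t0|->] := ltgtP t 0.
- rewrite !theta_le0 ?ltW// mulr0 subr0.
  apply: (@near_eq_is_derive _ _ _ (cst 0)) => //.
  by near=> x; rewrite theta_le0// ltW//; near: x; exact: lt_nbhsl.
- have E : is_derive t 1 (fun x => x^-1 ^+ n * expR (- x^-1))
     (theta n.+2 t - n%:R * theta n.+1 t).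
    have tn0 : t != 0 by rewrite gt_eqF.
    have dV : is_derive t 1 (fun x : R => x^-1) (- t ^- 2).
      by rewrite -[- _](mulr1 (- t ^- 2)); apply: (is_deriveV (f := id)).
    have dE : is_derive t 1 (fun x : R => expR (- x^-1)) (expR (- t^-1) * t ^- 2).
      apply: (@is_derive1_comp _ expR (fun x : R => - x^-1)).
      by apply: is_derive_eq; rewrite opprK.
    have D := is_deriveM (is_deriveX n dV) dE.
    rewrite (_ : (fun _ => _) = GRing.inv ^+ n * (fun x : R => expR (- x^-1))); last first.
      by apply/funext => x; rewrite fctE/= exprfctE.
    apply: is_derive_eq D _; rewrite exprfctE.
    rewrite /theta t0 /= /GRing.scale /=.
    rewrite -exprVn; move: (t^-1) (expR _) => z e.
    by case: n => [|n]; rewrite ?mulr0n -?pred_Sn ?exprS ?expr0; ring.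
  apply: (near_eq_is_derive _ E) => //.
  by near=> x; rewrite /theta ifT//; near: x; exact: lt_nbhsr.
- rewrite !(theta_le0 _ (lexx 0)) mulr0 subr0.
  (* At the origin the quadratic bound dominates the difference quotient by [(n+2)! * |h|]. *)
  have E : (fun h => h^-1 *: (theta n (h *: 1 + 0) - theta n 0)) @ 0^' --> (0 : R).
    apply/cvgr0Pnorm_le => e e0.
    near=> h.
    have h0 : h != 0 by near: h; exact: nbhs_dnbhs_neq.
    rewrite (theta_le0 n (lexx 0)) addr0 subr0 /GRing.scale /= mulr1 normrM.
    rewrite (ger0_norm (theta_ge0 _ _)) normfV ler_pdivrMl ?normr_gt0//.
    apply: le_trans (theta_le_sqr _ _) _; rewrite -real_normK ?num_real// expr2 mulrCA.
    rewrite ler_pM2l ?normr_gt0// -ler_pdivlMl ?ltr0n ?fact_gt0//.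
    near: h; apply: dnbhs0_le; rewrite mulr_gt0// invr_gt0 ltr0n fact_gt0.
  split; first by apply/cvg_ex; exists 0.
  exact: cvg_lim E.
Unshelve. all: by end_near.
Qed.

Definition xcoord (i : 'I_2) (x : plane R) : R := if i == ord0 then x.1 else x.2.

(** A syntactic class that contains the cut-offs and is stable under partial derivatives.
    Smoothness, a statement on all iterated derivatives, thus reduces to continuity and one
    differentiation of each member. *)
Inductive flat_alg : sfield R -> Prop :=
| flat_cst (c : R) : flat_alg (fun=> c)
| flat_theta n i (s c : R) : flat_alg (fun x => theta n (s * xcoord i x + c))
| flat_add f g : flat_alg f -> flat_alg g -> flat_alg (fun x => f x + g x)
| flat_mul f g : flat_alg f -> flat_alg g -> flat_alg (fun x => f x * g x).

Lemma continuous_theta n : continuous (theta n).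
Proof.
move=> t; apply: differentiable_continuous.
by apply/derivable1_diffP; have [] := is_derive_theta n t.
Qed.

Lemma continuous_xcoord i : continuous (xcoord i).
Proof.
by move=> [a b]; rewrite /xcoord; case: (i == ord0); [apply: cvg_fst|apply: cvg_snd].
Qed.

Lemma xcoord_axis i j (x : plane R) (h : R) :
  xcoord j (h *: axis i + x) = h * (i == j)%:R + xcoord j x.
Proof.
rewrite /xcoord /axis.
by case: i => -[|[|]]//= ?; case: j => -[|[|]]//= ?;
  rewrite /GRing.scale /= ?mulr1 ?mulr0.
Qed.

(** The difference quotient in the plane is the Kronecker symbol [(i == j)] times the one-variable
    quotient of [g]. *)
Lemma is_derive_xcoord (g : R -> R) (i j : 'I_2) (x : plane R) d :
  is_derive (xcoord j x) 1 g d ->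
  is_derive x (axis i) (fun x => g (xcoord j x)) (d * (i == j)%:R).
Proof.
move=> [dg dgE].
have E h : h^-1 *: (((fun x => g (xcoord j x)) \o shift x) (h *: axis i)
     - g (xcoord j x)) = (i == j)%:R
      * (h^-1 *: ((g \o shift (xcoord j x)) (h *: 1) - g (xcoord j x))).
  rewrite /= xcoord_axis /GRing.scale /= mulr1.
  by case: eqP => _; rewrite ?mulr1 ?mul1r// mulr0 add0r subrr !mulr0 mul0r.
have C : (fun h => h^-1 *: (((fun x => g (xcoord j x)) \o shift x) (h *: axis i)
     - g (xcoord j x))) @ 0^' --> d * (i == j)%:R.
  under eq_fun do rewrite E.
  rewrite mulrC; apply: cvgM; first exact: cvg_cst.
  by rewrite -dgE; exact: dg.
split; first by apply/cvg_ex; exists (d * (i == j)%:R).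
exact: cvg_lim C.
Qed.

Lemma flat_alg_continuous f : flat_alg f -> continuous f.
Proof.
elim=> [c|n i s c|{}f g _ cf _ cg|{}f g _ cf _ cg] x.
- exact: cvg_cst.
- apply: (@continuous_comp _ _ _ (fun x => s * xcoord i x + c) (theta n)).
    apply: (@cvgD _ _ _ _ _ (fun x => s * xcoord i x) (fun=> c)); last exact: cvg_cst.
    apply: (@cvgM _ _ _ _ (fun=> s) (xcoord i)); first exact: cvg_cst.
    exact: continuous_xcoord.
  exact: continuous_theta.
- exact: cvgD (cf x) (cg x).
- exact: cvgM (cf x) (cg x).
Qed.

Lemma is_derive_theta_affine n (s c t : R) :
  is_derive t 1 (fun t => theta n (s * t + c))
    ((theta n.+2 (s * t + c) - n%:R * theta n.+1 (s * t + c)) * s).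
Proof.
apply: (@is_derive1_comp _ (theta n) (fun t => s * t + c)).
  exact: is_derive_theta.
have D : is_derive t 1 (s \*: (id : R -> R) + cst c) s.
  by apply: is_derive_eq; rewrite addr0 /GRing.scale /= mulr1.
by [].
Qed.

Lemma flat_alg_derive f i : flat_alg f ->
  exists2 g, flat_alg g & forall x, is_derive x (axis i) f (g x).
Proof.
elim=> [c|n j s c|{}f g _ [f' Af' df] _ [g' Ag' dg]
  |{}f g Af [f' Af' df] Ag [g' Ag' dg]].
- by exists (fun=> 0); [exact: flat_cst|move=> x; exact: is_derive_cst].
- exists (fun x => ((theta n.+2 (s * xcoord j x + c)
      + (- n%:R) * theta n.+1 (s * xcoord j x + c)) * (s * (i == j)%:R))).
    apply: flat_mul (flat_cst _); apply: flat_add; first exact: flat_theta.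
    by apply: flat_mul; [exact: flat_cst|exact: flat_theta].
  move=> x; apply: is_derive_eq.
    exact: (is_derive_xcoord (g := fun t => theta n (s * t + c)) i
      (is_derive_theta_affine n s c (xcoord j x))).
  by rewrite mulrA mulNr.
- exists (fun x => f' x + g' x); first exact: flat_add.
  by move=> x; exact: is_deriveD.
- exists (fun x => f x * g' x + g x * f' x).
    by apply: flat_add; exact: flat_mul.
  by move=> x; exact: is_deriveM.
Qed.

Lemma flat_alg_pd f i : flat_alg f -> flat_alg (pd i f).
Proof.
move=> /(flat_alg_derive i)[g Ag dg].
by rewrite (_ : pd i f = g)//; apply/funext => x; have [_ <-] := dg x.
Qed.

Lemma flat_alg_smooth f : flat_alg f -> smooth f.
Proof.
move=> Af s h.
have {}Af : flat_alg h by rewrite /h; elim: s {h} => //= i s; exact: flat_alg_pd.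
split; first exact: flat_alg_continuous.
by move=> i x; have [g _ dg] := flat_alg_derive i Af; have [] := dg x.
Qed.

End FlatFunctions.

(** * Open boxes: countable covers, the sigma-algebra they generate, smooth cut-offs *)

Section Boxes.
Context {R : realType}.
Implicit Types p q x : plane R.

Definition obox p q : set (plane R) := `]p.1, q.1[ `*` `]p.2, q.2[.
Definition cbox p q : set (plane R) := `[p.1, q.1] `*` `[p.2, q.2].

Lemma obox_cbox p q : obox p q `<=` cbox p q.
Proof. by move=> x [? ?]; split; apply: subset_itv_oo_cc. Qed.

Lemma oboxI p q p' q' : obox p q `&` obox p' q' =
  obox (Num.max p.1 p'.1, Num.max p.2 p'.2) (Num.min q.1 q'.1, Num.min q.2 q'.2).
Proof.
apply/seteqP; split => x; rewrite /obox/= !in_itv/= !gt_max !lt_min.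
  by move=> [[/andP[-> ->] /andP[-> ->]] [/andP[-> ->] /andP[-> ->]]].
by move=> [/andP[/andP[-> ->] /andP[-> ->]] /andP[/andP[-> ->] /andP[-> ->]]].
Qed.

Lemma cbox_compact p q : compact (cbox p q).
Proof. by apply: compact_setX; exact: segment_compact. Qed.

Lemma cbox_closed p q : closed (cbox p q).
Proof.
apply: closedI; (apply: closed_comp; last exact: interval_closed) => x _.
  exact: (@continuous_xcoord R ord0 x).
exact: (@continuous_xcoord R ord_max x).
Qed.

(** Boxes with rational corners suffice, and there are countably many. Keeping the closed boxes
    inside [U] leaves room for test functions supported in them. *)
Lemma open_bigcup_obox (U : set (plane R)) : open U ->
  exists P Q : nat -> plane R, (forall n, cbox (P n) (Q n) `<=` U) /\
    U = \bigcup_n obox (P n) (Q n).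
Proof.
move=> oU.
pose r2 (u : rat * rat) : plane R := (ratr u.1, ratr u.2).
(* Enumerates the pairs of rational corners; codes that are invalid, or whose closed box leaves [U],
   are sent to the corners [(1, 1)], [(0, 0)] of an empty box. *)
pose F n : plane R * plane R :=
  if unpickle n is Some (u, v) then
    if `[< cbox (r2 u) (r2 v) `<=` U >] then (r2 u, r2 v) else ((1, 1), (0, 0))
  else ((1, 1), (0, 0)).
have FU n : cbox (F n).1 (F n).2 `<=` U.
  have E0 : cbox (1, 1) (0, 0) `<=` U.
    by move=> x [] /=; rewrite in_itv/= => /andP[/le_trans] /[apply]; rewrite ler10.
  rewrite /F; case: unpickle => [[u v]|//=].
  by case: asboolP.
exists (fst \o F), (snd \o F); split => //.
apply/seteqP; split => [x Ux|x [n _ /obox_cbox /FU]//].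
have /nbhs_ballP[e /= e0 xeU] : nbhs x U by exact: open_nbhs_nbhs.
have rl (t : R) : exists r, ratr r \in `]t - e, t[ by apply: rat_in_itvoo; rewrite gtrBl.
have rr (t : R) : exists r, ratr r \in `]t, t + e[ by apply: rat_in_itvoo; rewrite ltrDl.
have [a1] := rl x.1; have [a2] := rl x.2; have [b1] := rr x.1; have [b2] := rr x.2.
rewrite !in_itv/= => /andP[xb2 b2e] /andP[xb1 b1e] /andP[a2e a2x] /andP[a1e a1x].
have bU : cbox (r2 (a1, a2)) (r2 (b1, b2)) `<=` U.
  move=> y; rewrite /cbox/= !in_itv/= => -[/andP[ay1 yb1] /andP[ay2 yb2]].
  by apply: xeU; split; rewrite /ball/= ltr_distlC; apply/andP; split; lra.
have [n Fn] : exists n, F n = (r2 (a1, a2), r2 (b1, b2)).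
  by exists (pickle ((a1, a2), (b1, b2))); rewrite /F pickleK; case: asboolP.
exists n; first by [].
by split; rewrite Fn /= in_itv/= ?a1x ?xb1 ?a2x ?xb2.
Qed.

Lemma obox_measurable p q :
  measurable (obox p q : set (measurableTypeR R * measurableTypeR R)).
Proof. by apply: measurableX; exact: measurable_itv. Qed.

Lemma open_measurable2 (U : set (plane R)) : open U ->
  measurable (U : set (measurableTypeR R * measurableTypeR R)).
Proof.
move=> /open_bigcup_obox[P [Q [_ ->]]].
by apply: bigcupT_measurable => n; exact: obox_measurable.
Qed.

Lemma continuous_measurable2 (f : sfield R) : continuous f ->
  measurable_fun setT (f : measurableTypeR R * measurableTypeR R -> R).
Proof.
move=> cf; apply: (measurability _ (RGenOpens.measurableE R)).
move=> _ [_ [a [b ->]] <-]; rewrite setTI; apply: open_measurable2.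
by apply: open_comp => //; exact: interval_open.
Qed.

(** Lets Dynkin induction start from open boxes. Strips over open intervals are countable unions of
    boxes, so both projections are measurable for the generated sigma-algebra, and a measurable
    rectangle is an intersection of two strips. *)
Lemma measurable_obox_generated :
  @measurable _ (measurableTypeR R * measurableTypeR R)%type =
  <<s [set obox p q | p in setT & q in setT] >>.
Proof.
rewrite measurable_prod_measurableType.
set B := [set obox p q | p in _ & q in _].
apply/seteqP; split; last first.
  apply: smallest_sub; first exact: smallest_sigma_algebra.
  move=> _ [p _ [q _ <-]]; apply: sub_sigma_algebra.
  by exists `]p.1, q.1[%classic; [exact: measurable_itv|
    exists `]p.2, q.2[%classic => //; exact: measurable_itv].
have sB : sigma_algebra setT <<s B >> by exact: smallest_sigma_algebra.
have B1 (A : set R) : measurable (A : set (measurableTypeR R)) ->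
    <<s B >> (A `*` setT).
  move=> mA.
  have : measurable_fun setT (fst : g_sigma_algebraType B -> measurableTypeR R).
    apply: (measurability _ (RGenOpens.measurableE R)).
    move=> _ [_ [a [b ->]] <-].
    rewrite (_ : _ `&` _ = \bigcup_n (obox (a, - n%:R) (b, n%:R)
      : set (g_sigma_algebraType B))).
      by apply: bigcupT_measurable => n; apply: sub_sigma_algebra; exists (a, - n%:R) => //;
        exists (b, n%:R).
    rewrite setTI; apply/seteqP; split => [x /= xab|x [n _ []//]].
    have [n xn] : exists n, `|x.2| < n%:R by exists (Num.trunc `|x.2|).+1; exact: truncnS_gt.
    by exists n => //; split => //=; rewrite in_itv/= -ltr_norml.
  by move=> /(_ measurableT _ mA); rewrite setTI setXT.
have B2 (A : set R) : measurable (A : set (measurableTypeR R)) ->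
    <<s B >> (setT `*` A).
  move=> mA.
  have : measurable_fun setT (snd : g_sigma_algebraType B -> measurableTypeR R).
    apply: (measurability _ (RGenOpens.measurableE R)).
    move=> _ [_ [a [b ->]] <-].
    rewrite (_ : _ `&` _ = \bigcup_n (obox (- n%:R, a) (n%:R, b)
      : set (g_sigma_algebraType B))).
      by apply: bigcupT_measurable => n; apply: sub_sigma_algebra; exists (- n%:R, a) => //;
        exists (n%:R, b).
    rewrite setTI; apply/seteqP; split => [x /= xab|x [n _ []//]].
    have [n xn] : exists n, `|x.1| < n%:R by exists (Num.trunc `|x.1|).+1; exact: truncnS_gt.
    by exists n => //; split => //=; rewrite in_itv/= -ltr_norml.
  by move=> /(_ measurableT _ mA); rewrite setTI setTX.
apply: smallest_sub => //.
move=> _ [A mA [A' mA' <-]].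
rewrite -[A]setIT -[A']setTI setXI.
by apply: (@measurableI _ (g_sigma_algebraType B)); [exact: B1|exact: B2].
Qed.

Definition bump p q : sfield R := fun x =>
  theta 0 (x.1 - p.1) * theta 0 (q.1 - x.1)
  * (theta 0 (x.2 - p.2) * theta 0 (q.2 - x.2)).

Lemma flat_alg_bump p q : flat_alg (bump p q).
Proof.
have fB0 i c : flat_alg (fun x : plane R => theta 0 (xcoord i x - c)).
  by have := flat_theta 0 i 1 (- c); under eq_fun do rewrite mul1r.
have fB1 i c : flat_alg (fun x : plane R => theta 0 (c - xcoord i x)).
  by have := flat_theta 0 i (- 1) c; under eq_fun do rewrite mulN1r addrC.
apply: flat_mul; apply: flat_mul.
- exact: (fB0 ord0).
- exact: (fB1 ord0).
- exact: (fB0 ord_max).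
- exact: (fB1 ord_max).
Qed.

Lemma bump_ge0 p q x : 0 <= bump p q x.
Proof. by rewrite !mulr_ge0// theta_ge0. Qed.

Lemma bump_le1 p q x : bump p q x <= 1.
Proof.
by rewrite !mulr_ile1// ?mulr_ge0 ?theta_ge0 ?ltW ?theta0_lt1//
  mulr_ile1// ?theta_ge0 ?ltW ?theta0_lt1.
Qed.

Lemma bump_gt0 p q x : obox p q x -> 0 < bump p q x.
Proof.
rewrite /obox /= !in_itv /= => -[/andP[? ?] /andP[? ?]].
by rewrite !mulr_gt0// theta_gt0// subr_gt0.
Qed.

Lemma bump_eq0 p q x : ~ obox p q x -> bump p q x = 0.
Proof.
move=> nx; apply: contra_notP nx => /eqP.
rewrite /bump !mulf_eq0 !negb_or => /andP[/andP[a b] /andP[c d]].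
have pos t : theta 0 t != 0 :> R -> 0 < t.
  by apply: contraNT; rewrite -leNgt => /(theta_le0 0)->.
by split; rewrite /= in_itv/=; apply/andP; split; rewrite -subr_gt0; exact: pos.
Qed.

(* [bump] takes values in [[0, 1]] and is positive exactly on the box, so this
   increases to the indicator of the box. *)
Definition plateau p q n : sfield R := fun x => 1 - (1 - bump p q x) ^+ n.

Lemma flat_alg_plateau p q n : flat_alg (plateau p q n).
Proof.
have flatN f : flat_alg f -> flat_alg (fun x : plane R => 1 - f x).
  move=> Af; apply: flat_add; first exact: flat_cst.
  by under eq_fun do rewrite -mulN1r; apply: flat_mul Af; exact: flat_cst.
apply: (flatN); elim: n => [|n IH]; first by under eq_fun do rewrite expr0; exact: flat_cst.
under eq_fun do rewrite exprS; apply: flat_mul IH; apply: flatN.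
exact: flat_alg_bump.
Qed.

Lemma plateau_ge0 p q n x : 0 <= plateau p q n x.
Proof.
by rewrite subr_ge0 exprn_ile1// ?subr_ge0 ?bump_le1// gerBl bump_ge0.
Qed.

Lemma plateau_le1 p q n x : plateau p q n x <= 1.
Proof. by rewrite gerBl exprn_ge0// subr_ge0 bump_le1. Qed.

Lemma plateau_eq0 p q n x : ~ obox p q x -> plateau p q n x = 0.
Proof. by move=> nx; rewrite /plateau bump_eq0// subr0 expr1n subrr. Qed.

(** Off the box the sequence is constantly 0; on it [1 - bump] lies in [[0, 1)] and its powers tend
    to 0. *)
Lemma plateau_cvg p q x : plateau p q n x @[n --> \oo] --> (\1_(obox p q) x : R).
Proof.
rewrite indicE; have [xB|xB] := boolP (x \in obox p q); last first.
  rewrite (_ : (fun n => _) = cst 0); first exact: cvg_cst.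
  by apply/funext => n; rewrite plateau_eq0// => /mem_set; exact/negP.
rewrite -[X in _ --> X]subr0; apply: cvgB; first exact: cvg_cst.
apply: cvg_expr; rewrite ger0_norm ?subr_ge0 ?bump_le1// gtrBl bump_gt0//.
by rewrite inE in xB.
Qed.

Lemma plateau_test p q n (K : set (plane R)) : cbox p q `<=` K ->
  test_function K (plateau p q n).
Proof.
move=> qK.
have S : closure [set x | plateau p q n x != 0] `<=` cbox p q.
  rewrite [X in _ `<=` X](closure_id _).1; last exact: cbox_closed.
  apply: closureS => x /= x0; apply: obox_cbox.
  by apply: contrapT => /(plateau_eq0 n) /eqP; exact/negP.
split; first exact/flat_alg_smooth/flat_alg_plateau.
  apply: subclosed_compact S; first exact: closed_closure.
  exact: cbox_compact.
exact: subset_trans S qK.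
Qed.

End Boxes.

(** * Integrability on sets of finite measure and the fundamental lemma of the calculus of
    variations *)

Section FundamentalLemma.
Context {R : realType}.
Implicit Types (K D : set (plane R)) (f g : sfield R).
Local Notation mu := (@leb2 R).
Local Notation T2 := (measurableTypeR R * measurableTypeR R)%type.

Lemma leb2_setX (A B : set (measurableTypeR R)) : measurable A -> measurable B ->
  mu (A `*` B) = (@lebesgue_measure R A * @lebesgue_measure R B)%E.
Proof. exact: (@product_measure1E _ _ _ _ R lebesgue_measure lebesgue_measure). Qed.

Lemma leb2_cbox_lty p q : (mu (cbox p q) < +oo)%E.
Proof.
have lt (a b : R) : (@lebesgue_measure R `[a, b] < +oo)%E.
  by rewrite lebesgue_measure_itv/=; case: ifP => _; rewrite ?ltry// ltry.
have m (a b : R) : measurable (`[a, b]%classic : set (measurableTypeR R)).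
  exact: measurable_itv.
rewrite (leb2_setX (m _ _) (m _ _)).
rewrite lte_mul_pinfty//.
by rewrite ge0_fin_numE//; exact: lt.
Qed.

Lemma bounded_cbox D : bounded_set D -> exists p q, D `<=` cbox p q.
Proof.
move=> [M [_ /(_ (M + 1) (ltr_pwDr ltr01 (lexx M))) DM]].
exists (- (M + 1), - (M + 1)), (M + 1, M + 1) => x /DM /=.
by rewrite prod_normE ge_max => /andP[x1 x2]; split; rewrite /= in_itv/= -ler_norml.
Qed.

Lemma leb2_bounded_lty D : measurable (D : set T2) -> bounded_set D -> (mu D < +oo)%E.
Proof.
move=> mD /bounded_cbox[p [q Dpq]]; apply: le_lt_trans (leb2_cbox_lty p q).
apply: le_measure => //; rewrite inE//.
by apply: measurableX; exact: measurable_itv.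
Qed.

Lemma compact_support_bounded (phi : sfield R) : continuous phi ->
  compact (closure [set x | phi x != 0]) -> exists M, forall x, `|phi x| <= M.
Proof.
move=> cphi /(continuous_compact (continuous_subspaceT cphi)).
move=> /compact_bounded[N [_ /(_ (N + 1) (ltr_pwDr ltr01 (lexx N))) HM]].
set M := N + 1 in HM.
(* [M] bounds [phi] only on its support, which may be empty; the maximum with 0 covers the zeros of
   [phi]. *)
exists (Num.max M 0) => x; have [->|x0] := eqVneq (phi x) 0.
  by rewrite normr0 le_max lexx orbT.
by rewrite le_max HM//=; exists x => //; exact: subset_closure.
Qed.

Lemma L2_integrable_sqr D f : measurable (D : set T2) -> L2 D f ->
  mu.-integrable D (EFin \o (fun x => f x ^+ 2)).
Proof.
move=> mD /Lfun2_integrable_sqr H; apply/(integrable_mkcond _ mD).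
rewrite (_ : _ \_ D = EFin \o (fun x => (f \_ D) x ^+ 2)) //.
by apply/funext => x; rewrite /= !patchE; case: ifP => _ //=; rewrite expr0n.
Qed.

Lemma L2_measurable D f : measurable (D : set T2) -> L2 D f ->
  measurable_fun (D : set T2) f.
Proof.
move=> mD /andP[]; rewrite inE/= => mf _.
by apply/(measurable_restrictT _ mD).
Qed.

Lemma L2D D f g : L2 D f -> L2 D g -> L2 D (fun x => f x + g x).
Proof.
move=> Lf Lg; rewrite /L2/= (_ : _ \_ D = f \_ D + g \_ D).
  have p1 : (1 <= 2%:E :> \bar R)%E by rewrite lee1n.
  by have [_ D2] := Lfun_addr_closed mu p1; apply: D2.
by apply/funext => x; rewrite fctE !patchE; case: ifP => //; rewrite addr0.
Qed.

(** Domination by [1 + f^2], which is integrable as [D] has finite measure. *)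
Lemma integrable_of_sqr D f : measurable (D : set T2) -> (mu D < +oo)%E ->
  measurable_fun (D : set T2) f ->
  mu.-integrable D (EFin \o (fun x => f x ^+ 2)) ->
  mu.-integrable D (EFin \o f).
Proof.
move=> mD Dfin mf if2.
apply: (@le_integrable _ _ _ mu D mD _ (EFin \o (fun x => 1 + f x ^+ 2))).
- exact/measurable_EFinP.
- move=> x _ /=; rewrite lee_fin (@ger0_norm _ (1 + _)) ?addr_ge0 ?sqr_ge0//.
  rewrite -real_normK ?num_real//; have := sqr_ge0 (`|f x| - 1); nra.
- apply: (@integrableD _ _ _ mu D mD (cst 1%:E) (EFin \o (fun x => f x ^+ 2))) => //.
  apply: (@measurable_bounded_integrable _ _ _ mu (cst 1) D mD Dfin) => //.
  by exists 1; split => // M /ltW M1 x _ /=; rewrite normr1.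
Qed.

Lemma L2_integrable D f : measurable (D : set T2) -> (mu D < +oo)%E ->
  L2 D f -> mu.-integrable D (EFin \o f).
Proof.
move=> mD Dfin Lf; apply: integrable_of_sqr => //; first exact: L2_measurable.
exact: L2_integrable_sqr.
Qed.

Lemma integrable_mul_bounded D f phi M : measurable (D : set T2) ->
  mu.-integrable D (EFin \o f) -> continuous phi ->
  (forall x, `|phi x| <= M) ->
  mu.-integrable D (EFin \o (fun x => f x * phi x)).
Proof.
move=> mD fi cphi phiM.
apply: (@integrableMl _ _ _ mu D mD (EFin \o f) phi fi).
  by apply: measurable_funTS; exact: continuous_measurable2.
by exists M; split => [|N MN x _ /=]; [exact: num_real|exact: le_trans (phiM x) (ltW MN)].
Qed.

(** Dominated convergence along the plateaus of the box, with [|g|] as dominating function. *)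
Lemma integral_obox_eq0 K g p q : measurable (K : set T2) ->
  mu.-integrable K (EFin \o g) ->
  (forall phi, test_function K phi -> \int[mu]_(x in K) (g x * phi x) = 0) ->
  cbox p q `<=` K -> (\int[mu]_(x in obox p q) (g x)%:E = 0)%E.
Proof.
move=> mK gi g0 pqK.
have mg := measurable_int _ gi.
pose f_ n x := (g x * plateau p q n x)%:E.
have cpl n : continuous (plateau p q n) by exact/flat_alg_continuous/flat_alg_plateau.
have plM n x : `|plateau p q n x| <= 1.
  by rewrite ger0_norm ?plateau_ge0// plateau_le1.
have fi n : mu.-integrable K (f_ n).
  exact: integrable_mul_bounded gi (cpl n) (plM n).
pose f x := (g x * \1_(obox p q) x)%:E.
have mf : measurable_fun (K : set T2) f.
  apply/measurable_EFinP; apply: measurable_funM; first exact/measurable_EFinP.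
  by apply: measurable_indic; exact: obox_measurable.
have f_f : {ae mu, forall x, K x -> f_ ^~ x @ \oo --> f x}.
  apply: aeW => x _; apply: cvg_EFin; first exact: nearW.
  by apply: cvgM; [exact: cvg_cst|exact: plateau_cvg].
have f_g : {ae mu, forall x n, K x -> (`|f_ n x| <= (abse \o (EFin \o g)) x)%E}.
  by apply: aeW => x n _ /=; rewrite lee_fin normrM ler_piMr.
have [_ _] := dominated_convergence mK (fun n => measurable_int _ (fi n)) mf f_f
  (integrable_abse gi) f_g.
rewrite (_ : (fun n => _) = cst 0%E); last first.
  (* The real-valued integral is the [fine] part of the extended one, and [fine] sends infinities to
     0; finiteness is what lets the vanishing be transferred. *)
  apply/funext => n /=; rewrite -[LHS]fineK; last exact: integrable_fin_num.
  by have := g0 _ (plateau_test n pqK); rewrite /Rintegral => ->.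
move=> /cvg_lim L; transitivity (\int[mu]_(x in K) f x)%E; last by rewrite -L// lim_cst.
rewrite -[X in integral _ X](_ : K `&` obox p q = _); last first.
  by apply/setIidr; apply: subset_trans pqK; exact: obox_cbox.
rewrite integral_mkcondr; apply: eq_integral => x _.
by rewrite patchE /f indicE; case: ifP => _; rewrite ?mulr1 ?mulr0.
Qed.

(** The sets [S] on which [g] has zero integral over [S] intersected with the box form a Dynkin
    system containing all open boxes, hence all measurable sets. *)
Lemma ae_eq0_obox K g p q : measurable (K : set T2) ->
  mu.-integrable K (EFin \o g) ->
  (forall p q, cbox p q `<=` K -> (\int[mu]_(x in obox p q) (g x)%:E = 0)%E) ->
  cbox p q `<=` K -> ae_eq mu (obox p q) g (cst 0).
Proof.
move=> mK gi g0 pqK.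
pose Q : set T2 := obox p q; have mQ : measurable Q by exact: obox_measurable.
have QK : Q `<=` K by apply: subset_trans pqK; exact: obox_cbox.
have gQ : mu.-integrable Q (EFin \o g) by exact: integrableS gi.
have gQI S : measurable S -> mu.-integrable (S `&` Q) (EFin \o g).
  by move=> mS; apply: integrableS gQ => //; exact: measurableI.
have P S : measurable S -> (\int[mu]_(x in S `&` Q) (g x)%:E = 0)%E.
  rewrite measurable_obox_generated; move: S.
  apply: (@dynkin_induction _ T2 _
    (fun S => \int[mu]_(x in S `&` Q) (g x)%:E = 0)%E).
  - exact: measurable_obox_generated.
  - move=> _ _ [a _ [b _ <-]] [a' _ [b' _ <-]].
    by rewrite oboxI; do 2 eexists => //.
  - by rewrite setTI; exact: g0.
  - move=> _ [a _ [b _ <-]]; rewrite oboxI; apply: g0.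
    apply: subset_trans pqK => x; rewrite /cbox/= !in_itv/= !ge_max !le_min.
    by move=> [/andP[/andP[_ ->] /andP[_ ->]] /andP[/andP[_ ->] /andP[_ ->]]].
  (* Complements: the integrals over [S] and its complement within the box add up to the integral
     over the box, which is 0. *)
  - move=> S mS S0.
    have : (\int[mu]_(x in (S `&` Q) `|` (~` S `&` Q)) (g x)%:E = 0)%E.
      by rewrite -setIUl setUv setTI; exact: g0.
    rewrite integral_setU_EFin; first by rewrite S0 add0e.
    + exact: measurableI.
    + by apply: measurableI => //; exact: measurableC.
    + rewrite -setIUl setUv setTI; apply/measurable_EFinP; exact: measurable_int gQ.
    + by apply/disj_setPS => x [[Sx _] [nSx _]].
  - move=> F mF tF F0; rewrite setI_bigcupl integral_bigcup.
    + by rewrite eseries0.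
    + by apply/trivIsetP => i j _ _ ij; move/trivIsetP : tF => /(_ i j I I ij) Fij;
        rewrite setIACA Fij set0I.
    + by move=> k; exact: measurableI.
    + rewrite -setI_bigcupl; apply: gQI; exact: bigcupT_measurable.
have := integral_ae_eq mQ gQ (@measurable_cst _ _ _ _ Q 0%E).
have E : (forall E, E `<=` Q -> measurable E ->
    (\int[mu]_(x in E) (EFin \o g) x = \int[mu]_(x in E) (cst 0%E) x)%E).
  by move=> E EQ mE; rewrite integral0 -(setIidl EQ); exact: P.
move=> /(_ E); apply: filterS => x /= H /H; exact: EFin_inj.
Qed.

(** [K] is a countable union of boxes with closure in [K], and countably many null sets have null
    union. *)
Lemma fundamental_lemma K g : open K -> 
  mu.-integrable K (EFin \o g) ->
  (forall phi, test_function K phi -> \int[mu]_(x in K) (g x * phi x) = 0) ->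
  aeq K g (cst 0).
Proof.
move=> oK gi g0; have mK := open_measurable2 oK.
have [P [Q [PQK KE]]] := open_bigcup_obox oK.
have H n := ae_eq0_obox mK gi (fun p q => integral_obox_eq0 mK gi g0 (p:=p) (q:=q)) (PQK n).
rewrite /aeq.
have := ae_foralln H; apply: filterS => x /= Hx; rewrite KE => -[n _]; exact: Hx.
Qed.

End FundamentalLemma.

(** * Partial derivatives of test functions have zero integral *)

Section DivergenceTheorem.
Context {R : realType}.
Implicit Types (K D : set (plane R)) (phi : sfield R).
Local Notation mu := (@leb2 R).
Local Notation leb := (@lebesgue_measure R).
Local Notation T2 := (measurableTypeR R * measurableTypeR R)%type.

(** Off its closed support [phi] vanishes locally, so the derivative is 0 there and the support does
    not grow. *)
Lemma pd_test_function D phi i : test_function D phi -> test_function D (pd i phi).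
Proof.
move=> [sphi csupp suppD].
have S : closure [set x | pd i phi x != 0] `<=` closure [set x | phi x != 0].
  rewrite [X in _ `<=` X](closure_id _).1; last exact: closed_closure.
  apply: closureS => x /=; apply: contraNP => nx.
  have : \forall y \near x, cst 0 y = phi y.
    have : nbhs x (~` closure [set x | phi x != 0]).
      by apply: open_nbhs_nbhs; split => //; apply: closed_openC; exact: closed_closure.
    apply: filterS => y ny; apply/esym; apply: contrapT => /eqP y0.
    by apply: ny; exact: subset_closure.
  by move=> /near_eq_derive; rewrite /pd => <-; rewrite derive_cst.
split.
- move=> s; have := sphi (rcons s i).
  by rewrite foldr_rcons.
- by apply: subclosed_compact S => //; exact: closed_closure.
- exact: subset_trans S suppD.
Qed.

Lemma test_function_integrable D phi : test_function D phi ->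
  mu.-integrable setT (EFin \o phi).
Proof.
move=> [sphi csupp _]; have [cphi _] := sphi [::].
have [M phiM] := compact_support_bounded cphi csupp.
have [p [q spq]] := bounded_cbox (compact_bounded csupp).
have mpq : measurable (cbox p q : set T2) by apply: measurableX; exact: measurable_itv.
rewrite (_ : EFin \o phi = (EFin \o phi) \_ (cbox p q)); last first.
  apply/funext => x; rewrite patchE; case: ifPn => // xpq /=; congr EFin.
  apply: contraNeq xpq => x0; apply/mem_set/spq; exact: subset_closure.
apply/(integrable_mkcond _ mpq).
apply: (@measurable_bounded_integrable _ _ _ mu phi _ mpq (leb2_cbox_lty p q)).
  by apply: measurable_funTS; exact: continuous_measurable2.
by exists M; split => [|N MN x _ /=]; [exact: num_real|exact: le_trans (phiM x) (ltW MN)].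
Qed.

Lemma Rintegral_supportE D phi : (forall x, phi x != 0 -> D x) ->
  \int[mu]_(x in D) phi x = \int[mu]_x phi x.
Proof.
move=> phiD; rewrite Rintegral_mkcond; apply: eq_Rintegral => x _.
rewrite patchE; case: ifPn => // xD; apply/esym; apply: contraNeq xD => /phiD.
exact: mem_set.
Qed.

Lemma is_derive_line phi i z t : derivable phi (t *: axis i + z) (axis i) ->
  is_derive t 1 (fun t : R => phi (t *: axis i + z)) (pd i phi (t *: axis i + z)).
Proof.
move=> dphi.
have E : (fun h : R =>
    h^-1 *: (((fun t : R => phi (t *: axis i + z)) \o shift t) (h *: 1)
      - phi (t *: axis i + z))) =
  (fun h => h^-1 *: ((phi \o shift (t *: axis i + z)) (h *: axis i)
      - phi (t *: axis i + z))).
  by apply/funext => h /=; rewrite -[h *: 1]/(h * 1) mulr1 scalerDl addrA.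
by split; rewrite /derivable /derive/= E.
Qed.

Lemma continuous_line (f : sfield R) i z : continuous f ->
  continuous (fun t : R => f (t *: axis i + z)).
Proof.
move=> cf t; apply: (@continuous_comp _ _ _ (fun t : R => t *: axis i + z) f _ _ (cf _)).
apply: (@cvgD _ _ _ _ _ (fun t => t *: axis i) (cst z)); last exact: cvg_cst.
by apply: (@cvgZ _ _ _ _ _ id (cst (axis i))); [exact: cvg_id|exact: cvg_cst].
Qed.

Lemma integral_derive_compact_eq0 (F f : R -> R) (N : R) :
  (forall t : R, is_derive t 1 F (f t)) -> continuous f ->
  (forall t, N < `|t| -> F t = 0 /\ f t = 0) ->
  (\int[leb]_t (f t)%:E = 0)%E.
Proof.
move=> dF cf F0.
(* [M] exceeds [N], so [F] vanishes at both ends, and is positive even for negative [N], so the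
   interval is nondegenerate for the fundamental theorem of calculus. *)
pose M : R := `|N| + 1.
have NM : N < M by rewrite /M (le_lt_trans (ler_norm _))// ltrDl.
have M0 : 0 < M by rewrite /M ltr_wpDl.
have cF : continuous F.
  by move=> t; apply: differentiable_continuous; apply/derivable1_diffP; have [] := dF t.
transitivity (\int[leb]_(t in `[(- M)%R, M]) (f t)%:E)%E.
  rewrite [RHS]integral_mkcond; apply: eq_integral => t _.
  rewrite patchE; case: ifPn => // tM; rewrite (F0 t _).2//.
  rewrite ltNge; apply: contraNN tM => tN; apply/mem_set.
  by rewrite /= in_itv/= -ler_norml (le_trans tN)// ltW.
rewrite (@continuous_FTC2 _ f F).
- rewrite (F0 M _).1 ?(F0 (- M) _).1 ?subee//.
  + by rewrite normrN gtr0_norm.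
  + by rewrite gtr0_norm.
- by rewrite gtrN.
- exact: continuous_subspaceT.
- split; [by move=> t _; have [] := dF t|..].
  + apply: cvg_at_right_filter; exact: cF.
  + apply: cvg_at_left_filter; exact: cF.
- by move=> t _; rewrite derive1E; have [_ ->] := dF t.
Qed.

Lemma integral_pd_line D phi i (z : plane R) : test_function D phi ->
  (\int[leb]_t (pd i phi (t *: axis i + z))%:E = 0)%E.
Proof.
move=> tphi; have [sphi csupp _] := tphi.
have [cpd _] := sphi [:: i].
have [_ csupp' _] := pd_test_function i tphi.
have [p [q spq]] := bounded_cbox (compact_bounded csupp).
have [p' [q' spq']] := bounded_cbox (compact_bounded csupp').
have out a b (g : sfield R) (t : R) : closure [set x | g x != 0] `<=` cbox a b ->
    `|xcoord i z| + `|xcoord i a| + `|xcoord i b| < `|t| -> g (t *: axis i + z) = 0.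
  move=> sab; apply: contraTeq => g0.
  have [ab1 ab2] := sab _ (@subset_closure _ [set x | g x != 0] _ g0).
  have : xcoord i a <= t + xcoord i z <= xcoord i b.
    have -> : t + xcoord i z = xcoord i (t *: axis i + z).
      by rewrite xcoord_axis eqxx mulr1.
    by move: ab1 ab2; rewrite /xcoord; case: (i == ord0); rewrite /= !in_itv.
  rewrite -leNgt => /andP[az zb]; rewrite ler_norml.
  have := ler_norm (xcoord i b); have := lerNnormlW (lexx `|xcoord i a|).
  have := ler_norm (xcoord i z); have := lerNnormlW (lexx `|xcoord i z|).
  have := normr_ge0 (xcoord i a); have := normr_ge0 (xcoord i b).
  by move=> *; apply/andP; split; lra.
(* The sum of two thresholds: past the first the line has left the box around the support of [phi],
   past the second the box around that of [pd i phi]. *)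
pose N := (`|xcoord i z| + `|xcoord i p| + `|xcoord i q|)
        + (`|xcoord i z| + `|xcoord i p'| + `|xcoord i q'|).
apply: (@integral_derive_compact_eq0 (fun t => phi (t *: axis i + z)) _ N).
- move=> t; apply: is_derive_line; have [_ dphi] := sphi [::]; exact: dphi.
- exact: continuous_line cpd.
- move=> t Nt; split.
  + by apply: out spq _; apply: le_lt_trans Nt; rewrite lerDl !addr_ge0.
  + by apply: out spq' _; apply: le_lt_trans Nt; rewrite lerDr !addr_ge0.
Qed.

Lemma Rintegral_pd D phi i : test_function D phi ->
  \int[mu]_(x in D) pd i phi x = 0.
Proof.
move=> tphi; have tpd := pd_test_function i tphi.
rewrite Rintegral_supportE; last first.
  by have [_ _ S] := tpd; move=> x x0; apply: S; exact: subset_closure.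
have ipd := test_function_integrable tpd.
rewrite /Rintegral.
suff -> : (\int[mu]_x (pd i phi x)%:E = 0)%E by [].
(* Fubini, with the order of integration chosen so that the inner integral runs along axis [i],
   where it vanishes. *)
have [i0|i1] := eqVneq i ord0.
  rewrite -(integral21_prod_meas1 (m1 := leb) (m2 := leb) ipd).
  apply: integral0_eq => y _.
  rewrite /fubini_G -[RHS](integral_pd_line i (0, y) tphi).
  apply: eq_integral => x _ /=; congr (pd _ _ _)%:E.
  by rewrite /axis i0 eqxx; congr pair; rewrite /= /GRing.scale /= ?mulr1 ?mulr0 ?addr0 ?add0r.
rewrite -(integral12_prod_meas1 (m1 := leb) (m2 := leb) ipd).
apply: integral0_eq => x _.
rewrite /fubini_F -[RHS](integral_pd_line i (x, 0) tphi).
apply: eq_integral => y _ /=; congr (pd _ _ _)%:E.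
by rewrite /axis (negbTE i1); congr pair; rewrite /= /GRing.scale /= ?mulr1 ?mulr0 ?addr0 ?add0r.
Qed.

End DivergenceTheorem.

(** * Uniqueness, zero mean and vanishing of the weak divergence *)

Section WeakDivergence.
Context {R : realType}.
Implicit Types (K D : set (plane R)) (f g : sfield R) (v : vfield R).
Local Notation mu := (@leb2 R).
Local Notation T2 := (measurableTypeR R * measurableTypeR R)%type.

(** Test functions on [K] are test functions on [D], so [g1 - g2] is orthogonal to all of them on
    [K] and the fundamental lemma applies. *)
Lemma weak_pd_unique K D i f g1 g2 : open K -> open D -> K `<=` D ->
  (mu D < +oo)%E ->
  is_weak_pd D i f g1 -> is_weak_pd K i f g2 -> aeq K g1 g2.
Proof.
move=> oK oD KD Dfin [L1 E1] [L2 E2].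
have mK := open_measurable2 oK; have mD := open_measurable2 oD.
have Kfin : (mu K < +oo)%E.
  by apply: le_lt_trans Dfin; apply: le_measure => //; rewrite inE.
have i1 : mu.-integrable K (EFin \o g1).
  by apply: integrableS (L2_integrable mD Dfin L1).
have i2 := L2_integrable mK Kfin L2.
have supp h phi : (forall x, phi x != 0 -> K x) ->
    \int[mu]_(x in D) (h x * phi x) = \int[mu]_(x in K) (h x * phi x).
  move=> phiK; have hK x : h x * phi x != 0 -> K x.
    by rewrite mulf_eq0 negb_or => /andP[_ /phiK].
  by rewrite (Rintegral_supportE hK) (@Rintegral_supportE _ D)// => x /hK /KD.
have : aeq K (fun x => g1 x - g2 x) (cst 0).
  apply: fundamental_lemma => //; first exact: (integrableB mK i1 i2).
  move=> phi tphi; have [sphi csupp suppK] := tphi.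
  have [cphi _] := sphi [::].
  have [M phiM] := compact_support_bounded cphi csupp.
  have tD : test_function D phi by split => //; exact: subset_trans suppK KD.
  have [_ _ dsuppK] := pd_test_function i tphi.
  under eq_Rintegral do rewrite mulrBl.
  rewrite RintegralB//; [|exact: integrable_mul_bounded phiM..].
  apply/eqP; rewrite subr_eq0 -eqr_opp -(E2 _ tphi) -(supp g1); last first.
    by move=> x x0; apply: suppK; exact: (@subset_closure _ [set x | phi x != 0]).
  rewrite -(E1 _ tD) (supp f)// => x x0; apply: dsuppK.
  exact: (@subset_closure _ [set x | pd i phi x != 0]).
by apply: filterS => x /= /[apply] /eqP; rewrite subr_eq0 => /eqP.
Qed.

Lemma wpdP D i f : H1 D f -> is_weak_pd D i f (wpd D i f).
Proof. by move=> [_ /(_ i)[g gP]]; apply: (xgetPex 0 (ex_intro _ g gP)). Qed.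

(** The derivatives of the approximating test functions have zero integral, and on a set of finite
    measure their L2 convergence passes this to the limit. *)
Lemma Rintegral_wpd_H10 D i f : open D -> (mu D < +oo)%E -> H10 D f ->
  \int[mu]_(x in D) wpd D i f x = 0.
Proof.
move=> oD Dfin [Hf [phi [tphi [_ /(_ i) cvphi]]]].
have mD := open_measurable2 oD.
have [Lg _] := wpdP i Hf; set g := wpd D i f in Lg cvphi *.
have ig := L2_integrable mD Dfin Lg; have ig2 := L2_integrable_sqr mD Lg.
apply/eqP; rewrite -normr_eq0; apply: contrapT => /negP c0.
set c := `|_| in c0; have {}c0 : 0 < c by rewrite lt0r c0 normr_ge0.
pose m := fine (mu D); have m0 : 0 <= m by exact: fine_ge0.
(* Chosen so that [e * m <= c], also when [m = 0]. With [s] the integral of [d n ^+ 2], Young's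
   inequality gives [2 * e * c <= e * (e * m) + s <= e * c + s], hence [c * e <= s], against
   [s < c * e] for large [n]. *)
pose e := c / (m + 1); have e0 : 0 < e by rewrite divr_gt0// ltr_wpDl.
pose d n x := pd i (phi n) x - g x.
have tpd n := pd_test_function i (tphi n).
have ipd n : mu.-integrable D (EFin \o pd i (phi n)).
  exact: integrableS (test_function_integrable (tpd n)).
have id n : mu.-integrable D (EFin \o d n) by exact: (integrableB mD (ipd n) ig).
have id2 n : mu.-integrable D (EFin \o (fun x => d n x ^+ 2)).
  have [/(_ [::])[cpd _] csupp _] := tpd n.
  have [M pdM] := compact_support_bounded cpd csupp.
  have ipd2 := integrable_mul_bounded mD (ipd n) cpd pdM.
  apply: (@le_integrable _ _ _ mu D mD _ (EFin \o
      (fun x => 2 * (pd i (phi n) x * pd i (phi n) x) + 2 * g x ^+ 2))).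
  - apply/measurable_EFinP; apply: measurable_funX.
    by apply/measurable_EFinP; exact: measurable_int (id n).
  - move=> x _ /=; rewrite lee_fin !ger0_norm ?sqr_ge0//; last first.
      by rewrite addr_ge0// mulr_ge0// ?sqr_ge0// -expr2 sqr_ge0.
    (* [(a - b)^2 <= 2 a^2 + 2 b^2], because the gap is [(a + b)^2]. *)
    by rewrite /d; have := sqr_ge0 (pd i (phi n) x + g x); nra.
  - exact: (integrableD mD (integrableZl mD 2 ipd2) (integrableZl mD 2 ig2)).
have : \forall n \near \oo, \int[mu]_(x in D) (d n x ^+ 2) < c * e.
  have /cvgr0Pnorm_lt/(_ _ (mulr_gt0 c0 e0)) := cvphi.
  by apply: filterS => n; apply: le_lt_trans; exact: ler_norm.
case=> n _ /(_ n (leqnn n)) /=.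
apply/negP; rewrite -leNgt.
(* Young: [|d| <= e / 2 + d^2 / (2 e)]. *)
have ce : c <= e / 2 * m + (2 * e)^-1 * \int[mu]_(x in D) (d n x ^+ 2).
  have -> : c = `|\int[mu]_(x in D) d n x|.
    by rewrite RintegralB// (Rintegral_pd i (tphi n)) sub0r normrN.
  apply: le_trans (le_normr_Rintegral mD (id n)) _.
  have ic r : mu.-integrable D (EFin \o cst r).
    apply: (@measurable_bounded_integrable _ _ _ mu (cst r) D mD Dfin) => //.
    by exists `|r|; split => [|M /ltW Mr x _ //=]; exact: num_real.
  rewrite -(Rintegral_cst mu mD) -RintegralZl// -RintegralD//;
    [|exact: ic|exact: (integrableZl mD (2 * e)^-1 (id2 n))].
  apply: le_Rintegral => //.
  + exact: integrable_abse (id n).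
  + apply: (integrableD mD (ic (e / 2)) (integrableZl mD (2 * e)^-1 (id2 n))).
  + move=> x _; rewrite -real_normK ?num_real//.
    rewrite -(ler_pM2l (mulr_gt0 (ltr0n R 2) e0)) [leRHS](_ : _ = e ^+ 2 + `|d n x| ^+ 2).
      by have := sqr_ge0 (`|d n x| - e); nra.
    by field; rewrite gt_eqF.
have em : e * m <= c.
  rewrite /e mulrAC ler_pdivrMr ?ltr_wpDl// mulrDr mulr1 lerDl ltW//.
set s := \int[mu]_(x in D) _ in ce *.
have : 2 * e * c <= e * (e * m) + s.
  have := ler_wpM2l (ltW (mulr_gt0 (ltr0n R 2) e0)) ce.
  by rewrite [leRHS](_ : _ = e * (e * m) + s)//; field; rewrite gt_eqF.
nra.
Qed.

Lemma wdivE D v x : wdiv D v x = wpd D ord0 (v ord0) x + wpd D ord_max (v ord_max) x.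
Proof. by rewrite /wdiv big_ord_recl big_ord1; congr (_ + wpd _ _ (v _) _); exact/val_inj. Qed.

Lemma wdiv_L20 D v : open D -> (mu D < +oo)%E -> (forall i, H10 D (v i)) ->
  L20 D (wdiv D v).
Proof.
move=> oD Dfin Hv; have mD := open_measurable2 oD.
have L i : L2 D (wpd D i (v i)) by have [/wpdP -/(_ i)[]] := Hv i.
have wE : wdiv D v = fun x => wpd D ord0 (v ord0) x + wpd D ord_max (v ord_max) x.
  by apply/funext => x; exact: wdivE.
split; first by rewrite wE; exact: L2D.
rewrite wE RintegralD//; [|exact: L2_integrable..].
have Z i : \int[mu]_(x in D) wpd D i (v i) x = 0 by exact: Rintegral_wpd_H10.
by rewrite -[RHS]addr0; congr (_ + _); exact: Z.
Qed.

(** Each domain picks its own representatives of the weak derivatives; this transfers the polynomial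
    form of the divergence from a cell to the restriction of the global one. *)
Lemma wdiv_sub_aeq K D v : open K -> open D -> K `<=` D -> (mu D < +oo)%E ->
  (forall i, H1 D (v i)) -> (forall i, H1 K (v i)) ->
  aeq K (wdiv D v) (wdiv K v).
Proof.
move=> oK oD KD Dfin HD HK.
have H i := weak_pd_unique oK oD KD Dfin (wpdP i (HD i)) (wpdP i (HK i)).
apply: filterS2 (H ord0) (H ord_max) => x H0 H1' Kx.
by rewrite !wdivE H0// H1'.
Qed.

Lemma Rintegral_sqr_eq0 D g : measurable (D : set T2) -> L2 D g ->
  \int[mu]_(x in D) (g x * g x) = 0 -> aeq D g (cst 0).
Proof.
move=> mD Lg g0; have ig2 := L2_integrable_sqr mD Lg.
have : (\int[mu]_(x in D) `|(g x ^+ 2)%:E| = 0)%E.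
  under eq_integral do rewrite gee0_abs ?lee_fin ?sqr_ge0// expr2.
  rewrite -[LHS]fineK; first by move: g0; rewrite /Rintegral => ->.
  have := integrable_fin_num mD ig2.
  by under eq_integral do rewrite /= expr2.
move/(ae_eq_integral_abs mu mD (measurable_int _ ig2)).
apply: filterS => x /= /[apply] -[] /eqP; rewrite sqrf_eq0 => /eqP.
exact.
Qed.

Lemma polygon_leb2_lty (P : polygon R) : (mu P < +oo)%E.
Proof.
apply: leb2_bounded_lty; last exact: dom_bounded.
apply: open_measurable2; exact: dom_open.
Qed.

Lemma wdiv_Zh_eq0 nu k (Omega : polygon R) (T : decomposition Omega) v :
  Zh nu k T v -> aeq Omega (wdiv Omega v) (cst 0).
Proof.
move=> [[Hv VKv] bv]; have oO := @dom_open _ Omega.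
have Ofin := polygon_leb2_lty Omega.
have Lq := wdiv_L20 oO Ofin Hv.
apply: Rintegral_sqr_eq0; [exact: open_measurable2|by case: Lq|].
apply: bv; split => // j.
(* Membership of [wdiv Omega v] in [Qh]: [VK] supplies the polynomial for the divergence computed on
   the cell, which agrees a.e. there with the one computed on [Omega]. *)
have [HK _ [p Pp wp] _] := VKv j; exists p => //.
apply: filterS2 (wdiv_sub_aeq (@dom_open _ (cell j)) oO (@cell_sub _ _ T j) Ofin
  (fun i => (Hv i).1) HK) wp => x E1 E2 Kx.
by rewrite E1// E2.
Qed.

Lemma bform_wdiv_eq0 (Omega : polygon R) v q : (forall i, H10 Omega (v i)) ->
  L20 Omega q -> aeq Omega (wdiv Omega v) (cst 0) -> bform Omega v q = 0.
Proof.
move=> Hv [Lq _] w0; have oO := @dom_open _ Omega; have mO := open_measurable2 oO.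
have [Lw _] := wdiv_L20 oO (polygon_leb2_lty Omega) Hv.
rewrite /bform /Rintegral (@ae_eq_integral _ _ _ mu Omega (cst 0%E))//.
- by rewrite integral0.
- by apply/measurable_EFinP; apply: measurable_funM; exact: L2_measurable.
- by apply: filterS w0 => x /= /[apply] ->; rewrite mul0r.
Qed.

End WeakDivergence.

(** * Inclusion of the discrete kernel and exactly divergence-free discrete velocities *)

Theorem mainTheorem2 (R : realType) (Omega : polygon R) (k : nat)
  (k_ge2 : (2 <= k)%N)
  (T : nat -> decomposition Omega)
  (gamma c : R) (gamma_gt0 : 0 < gamma) (c_gt0 : 0 < c)
  (A1 : forall n (j : 'I_(ncell (T n))), star_shaped_ball gamma (cell j))
  (A2 : forall n (j : 'I_(ncell (T n))), separated_vertices c (cell j))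
  (nu : sfield R) (nu_Linfty : Linfty Omega nu)
  (nu_pos : exists2 nu0 : R, 0 < nu0 &
     {ae leb2 R, forall x, (Omega : set (plane R)) x -> nu0 <= nu x})
  (nu_const : forall n (j : 'I_(ncell (T n))),
     exists a : R, aeq (cell j) nu (cst a))
  (f : vfield R) (f_L2 : forall i, L2 Omega (f i))
  (cl cu : R) (cl_gt0 : 0 < cl) (cu_gt0 : 0 < cu)
  (S : forall n, 'I_(ncell (T n)) -> vfield R -> vfield R -> R)
  (S_stab : forall n (j : 'I_(ncell (T n))),
     stabilization nu k cl cu (cell j) (S n j)) :
  forall n,
    Zh nu k (T n) `<=` Zspace Omega /\
    forall (uh : vfield R) (ph : sfield R),
      Vh nu k (T n) uh -> Qh k (T n) ph ->
      (forall vh, Vh nu k (T n) vh ->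
         ah nu k (S n) uh vh + bform Omega vh ph
         = dotL2 Omega (fh k (T n) f) vh) ->
      (forall qh, Qh k (T n) qh -> bform Omega uh qh = 0) ->
      aeq Omega (wdiv Omega uh) (cst 0).
Proof.
move=> n; split => [v Zv|uh ph Vuh _ _ buh]; last first.
  (* [Vuh] and the discrete constraint [buh] together say that [uh] lies in [Zh]. *)
  exact: (@wdiv_Zh_eq0 _ nu k _ (T n)).
have [[Hv _] _] := Zv; split => // q Lq.
by apply: bform_wdiv_eq0 => //; exact: wdiv_Zh_eq0 Zv.
Qed.
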